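(* Let $p\ge1$, let $q\ge1$, let $p+q\ge3$, and set $m=p+q$. There exists $\Gamma\in\mathcal{Z}(p,q)$ so that $G_\Gamma^+$ is not compact. Consequently, neither the action of $\operatorname{GL}^+(m,\mathbb{R})$ on $\mathcal{Z}(p,q)$ nor the action of $\operatorname{GL}^+(m,\mathbb{R})$ on $\mathcal{W}(p,q)$ is proper.
   Context: $\mathcal{W}(m)=(\mathbb{R}^m)^*\otimes(\mathbb{R}^m)^*\otimes\mathbb{R}^m$ is the vector space of arrays $\Gamma=(\Gamma_{ij}{}^k)_{1\le i,j,k\le m}$ of real constants (constant Christoffel symbols on $\mathbb{R}^m$), and $\mathcal{Z}(m)\subset\mathcal{W}(m)$ is the subspace where $\Gamma_{ij}{}^k=\Gamma_{ji}{}^k$ (torsion free). Repeated indices are summed. The Ricci tensor of $\Gamma$ is $\rho_{\Gamma,jk}=\Gamma_{in}{}^i\Gamma_{jk}{}^n-\Gamma_{jn}{}^i\Gamma_{ik}{}^n$, and the symmetric Ricci tensor is $\rho_{s,\Gamma,jk}=\frac12(\rho_{\Gamma,jk}+\rho_{\Gamma,kj})$. For $p+q=m$, $\mathcal{W}(p,q)$ (resp. $\mathcal{Z}(p,q)$) is the set of $\Gamma\in\mathcal{W}(m)$ (resp. $\mathcal{Z}(m)$) for which $\rho_{s,\Gamma}$ is non-degenerate with signature $(p,q)$: $p$ negative and $q$ positive directions. $\operatorname{GL}^+(m,\mathbb{R})$ is the group of linear maps of $\mathbb{R}^m$ with positive determinant. It acts on $\mathcal{W}(m)$, preserving $\mathcal{Z}(m)$,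 by $(T\Gamma)(e_i,e_j,e^k)=\Gamma(Te_i,Te_j,Te^k)$, where $\Gamma(e_i,e_j,e^k)=\Gamma_{ij}{}^k$ and $T$ acts on covectors by the dual action (so that $\langle Te^k,Te_i\rangle=\delta^k_i$). Set $G_\Gamma^+:=\{T\in\operatorname{GL}^+(m,\mathbb{R}):T\Gamma=\Gamma\}$. An action of a Lie group $G$ on a space $N$ is proper if whenever $P_n\in N$, $g_n\in G$ with $P_n\to P\in N$ and $g_nP_n\to\tilde P\in N$, some subsequence of $g_n$ converges in $G$. *)

(* Defs.v *)
From HB Require Import structures.
From mathcomp Require Import all_boot all_order all_algebra.
From mathcomp Require Import all_classical all_reals all_analysis.

Set Implicit Arguments.
Unset Strict Implicit.
Unset Printing Implicit Defensive.

Import Order.TTheory GRing.Theory Num.Theory.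
Import numFieldNormedType.Exports.

Local Open Scope classical_set_scope.
Local Open Scope ring_scope.

(* [G i j k] is the Christoffel symbol with lower indices [i], [j] and upper
   index [k].  Since ['I_m] is finite, the pointwise topology is the usual
   topology of the vector space of dimension [m ^ 3]. *)
Definition christoffel (R : realType) (m : nat) : Type :=
  {ptws 'I_m -> {ptws 'I_m -> {ptws 'I_m -> R}}}.

Definition torsion_free (R : realType) (m : nat) (G : christoffel R m) : Prop :=
  forall i j k, G i j k = G j i k.

Definition ricci (R : realType) (m : nat) (G : christoffel R m) : 'M[R]_m :=
  \matrix_(j, k) \sum_(i < m) \sum_(n < m)
     (G i n i * G j k n - G j n i * G i k n).

Definition ricci_sym (R : realType) (m : nat) (G : christoffel R m) :
    'M[R]_m :=
  2^-1 *: (ricci G + (ricci G)^T).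

(* Some basis, given by the rows of [B], is orthogonal for the form [S], with
   [p] vectors of square -1 followed by [q] vectors of square +1.  As [S] has
   size [p + q], this includes non-degeneracy. *)
Definition has_signature (R : realType) (p q : nat) (S : 'M[R]_(p + q)) :
    Prop :=
  exists2 B : 'M[R]_(p + q), B \in unitmx &
    B *m S *m B^T = block_mx (- 1%:M) 0 0 1%:M.

Definition Wpq (R : realType) (p q : nat) : set (christoffel R (p + q)) :=
  [set G | has_signature (ricci_sym G)].

Definition Zpq (R : realType) (p q : nat) : set (christoffel R (p + q)) :=
  [set G | torsion_free G /\ has_signature (ricci_sym G)].

Arguments Wpq : clear implicits.
Arguments Zpq : clear implicits.

Definition GLplus (R : realType) (m : nat) : set 'M[R]_m :=
  [set T | 0 < \det T].

Arguments GLplus : clear implicits.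

(* The array [G] as a trilinear form on two vectors (columns) and one covector
   (row). *)
Definition chr_eval (R : realType) (m : nat) (G : christoffel R m)
    (x y : 'cV[R]_m) (w : 'rV[R]_m) : R :=
  \sum_(i < m) \sum_(j < m) \sum_(k < m) x i 0 * y j 0 * w 0 k * G i j k.

(* The pairing of a covector with a vector is [w *m x], so the dual action of
   [T] on covectors is [w |-> w *m invmx T].  With this formula
   [chr_act S (chr_act T G) = chr_act (T *m S) G] for invertible [S] and [T]:
   it is a right action. *)
Definition chr_act (R : realType) (m : nat) (T : 'M[R]_m)
    (G : christoffel R m) : christoffel R m :=
  fun i j k => chr_eval G (T *m delta_mx i 0) (T *m delta_mx j 0)
                          (delta_mx 0 k *m invmx T).

Definition GLplus_stab (R : realType) (m : nat) (G : christoffel R m) :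
    set 'M[R]_m :=
  [set T | GLplus R m T /\ chr_act T G = G].

(* [G] and [N] carry the subspace topologies of [gT] and [nT]. *)
Definition proper_action (gT nT : topologicalType) (G : set gT) (N : set nT)
    (act : gT -> nT -> nT) : Prop :=
  forall (P : nat -> nT) (g : nat -> gT) (P0 P1 : nT),
    (forall n, N (P n)) -> (forall n, G (g n)) -> N P0 -> N P1 ->
    P @ \oo --> P0 ->
    (fun n => act (g n) (P n)) @ \oo --> P1 ->
    exists (s : nat -> nat) (h : gT),
      [/\ {homo s : a b / (a < b)%N}, G h & (g \o s) @ \oo --> h].

(* Main.v *)
(* Let eta = diag(e) with e_i = -1 or 1, and let z be a basis index.  The symbols
   c eta_ij z^k + z_i delta_j^k + z_j delta_i^k + d z_i z_j z^k are fixed by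
   every isometry of eta that fixes e_z and e^z, and their Ricci tensor is a
   combination of eta and z (x) z; suitable c and d make it equal to eta.  When
   m >= 3 the index z can avoid one negative and one positive direction, and the
   hyperbolic rotations in the plane of these two form an unbounded family in
   the isotropy group. *)
Require Import Defs.
From mathcomp Require Import all_boot all_order all_algebra.
From mathcomp Require Import all_classical all_reals all_analysis.
From mathcomp Require Import zify ring lra.

Import Order.TTheory GRing.Theory Num.Theory.
Import numFieldNormedType.Exports.

Local Open Scope classical_set_scope.
Local Open Scope ring_scope.

(** * Ricci tensor of the symbols *)

Lemma sum_deltal (R : pzRingType) (I : finType) (z : I) (F : I -> R) :
  \sum_i (i == z)%:R * F i = F z.
Proof.
rewrite (bigD1 z) //= eqxx mul1r big1 ?addr0 // => i /negPf ->.
by rewrite mul0r.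
Qed.

Definition warped (R : realType) (m : nat) (e : 'I_m -> R) (z : 'I_m)
    (c d : R) : christoffel R m :=
  fun i j k => c * (e j * (i == j)%:R) * (k == z)%:R
    + ((i == z)%:R * (k == j)%:R + (j == z)%:R * (k == i)%:R)
    + d * ((i == z)%:R * (j == z)%:R * (k == z)%:R).

Lemma warped_torsion_free (R : realType) (m : nat) (e : 'I_m -> R)
    (z : 'I_m) (c d : R) :
  torsion_free (warped R m e z c d).
Proof.
move=> i j k; rewrite /warped (eq_sym j i).
case: (eqVneq i j) => [->|_] /=; ring.
Qed.

Lemma sum_warped (R : realType) (m : nat) (e : 'I_m -> R) (z : 'I_m)
    (c d : R) (i j : 'I_m) (F : 'I_m -> R) :
  \sum_k warped R m e z c d i j k * F k =
  (c * (e j * (i == j)%:R) + d * ((i == z)%:R * (j == z)%:R)) * F z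
  + ((i == z)%:R * F j + (j == z)%:R * F i).
Proof.
rewrite -(sum_deltal _ _ z F) -(sum_deltal _ _ j F) -(sum_deltal _ _ i F).
rewrite !mulr_sumr -!big_split /=.
by apply: eq_bigr => k _; rewrite /warped; ring.
Qed.

Lemma warped_trace (R : realType) (m : nat) (e : 'I_m -> R) (z : 'I_m)
    (c d : R) (n : 'I_m) :
  \sum_i warped R m e z c d i n i = (c * e z + (m%:R + 1) + d) * (n == z)%:R.
Proof.
transitivity (\sum_i ((i == n)%:R * (c * e n * (n == z)%:R)
     + ((i == z)%:R * (i == n)%:R + (n == z)%:R)
     + (i == z)%:R * (d * (n == z)%:R))).
  apply: eq_bigr => i _; rewrite /warped eqxx.
  by case: (eqVneq i n) => [->|_]; case: eqP => _ /=; ring.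
rewrite !big_split /= !sum_deltal sumr_const card_ord -mulr_natl.
rewrite (eq_sym z n).
by case: (eqVneq n z) => [->|_] /=; ring.
Qed.

Lemma ricci_warped (R : realType) (m : nat) (e : 'I_m -> R) (z : 'I_m)
    (c d : R) (j k : 'I_m) :
  let G := warped R m e z c d in
  let t := c * e z + (m%:R + 1) + d in
  ricci G j k = t * G j k z
    - (c * e k * G j z k + d * (k == z)%:R * G j z z + G j k z
       + t * ((j == z)%:R * (k == z)%:R)).
Proof.
move=> G t; rewrite mxE.
(* The quadratic term is reordered so that [n] is the upper index of its first factor, the form that
   [sum_warped] contracts. *)
transitivity (\sum_n (\sum_i G i n i) * G j k n
              - \sum_i \sum_n G i k n * G j n i).
  rewrite [X in X - _](_ : _ = \sum_i \sum_n G i n i * G j k n); last first.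
    rewrite exchange_big /=.
    by apply: eq_bigr => n _; rewrite mulr_suml.
  rewrite -sumrB; apply: eq_bigr => i _; rewrite -sumrB.
  by apply: eq_bigr => n _; rewrite [G i k n * _]mulrC.
congr (_ - _).
  rewrite -(sum_deltal _ _ z (G j k)) mulr_sumr; apply: eq_bigr => n _.
  by rewrite warped_trace mulrA.
under eq_bigr => i _ do rewrite sum_warped.
(* Torsion-freeness turns the last summand into a term of the trace. *)
transitivity (\sum_i ((i == k)%:R * (c * e k * G j z i)
   + (i == z)%:R * (d * (k == z)%:R * G j z i)
   + (i == z)%:R * G j k i + (k == z)%:R * G i j i)).
  apply: eq_bigr => i _.
  by rewrite [G j i i]warped_torsion_free -/G; ring.
by rewrite !big_split /= !sum_deltal -mulr_sumr warped_trace -/t; ring.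
Qed.

(** Off-diagonal entries vanish for all [c] and [d]. The first equation normalizes the diagonal
    entries away from [z], the second the entry at [z], which equals
    [(m - 1) * (c * e z + d + 1)]. *)
Lemma ricci_warped_diag (R : realType) (m : nat) (e : 'I_m -> R) (z : 'I_m)
    (c d : R) :
  c * (c * e z + m%:R - 1 + d) = 1 ->
  (m%:R - 1) * (c * e z + d + 1) = e z ->
  forall j k, ricci (warped R m e z c d) j k = e k * (j == k)%:R.
Proof.
move=> hc hd j k; rewrite ricci_warped /warped !eqxx.
rewrite (eq_sym z k) (eq_sym z j) (eq_sym k j).
case: (eqVneq j k) => [->|njk].
  case: (eqVneq k z) => [->|_] /=.
    by rewrite [RHS]mulr1; apply: (etrans _ hd); ring.
  rewrite -[X in _ = _ * X]hc; ring.
case: (eqVneq j z) => [ej|_]; case: (eqVneq k z) => [ek|_] /=; try ring.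
by rewrite ej ek eqxx in njk.
Qed.

(** * Invariance of the symbols under isometries *)

Lemma chr_eval_warped (R : realType) (m : nat) (e : 'I_m -> R) (z : 'I_m)
    (c d : R) (x y : 'cV[R]_m) (w : 'rV[R]_m) :
  chr_eval (warped R m e z c d) x y w =
  c * (x^T *m diag_mx (\row_i e i) *m y) 0 0 * w 0 z
  + (x z 0 * (w *m y) 0 0 + y z 0 * (w *m x) 0 0)
  + d * (x z 0 * y z 0 * w 0 z).
Proof.
rewrite /chr_eval.
transitivity (\sum_i \sum_j x i 0 * y j 0 *
   ((c * (e j * (i == j)%:R) + d * ((i == z)%:R * (j == z)%:R)) * w 0 z
  + ((i == z)%:R * w 0 j + (j == z)%:R * w 0 i))).
  apply: eq_bigr => i _; apply: eq_bigr => j _.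
  rewrite -sum_warped mulr_sumr.
  by apply: eq_bigr => k _; ring.
transitivity (\sum_i (c * w 0 z * (x i 0 * e i * y i 0)
   + (i == z)%:R * (d * w 0 z * y z 0 * x i 0 + x i 0 * (w *m y) 0 0)
   + y z 0 * (w 0 i * x i 0))).
  apply: eq_bigr => i _.
  transitivity (\sum_j ((j == i)%:R * (x i 0 * y j 0 * c * e j * w 0 z)
     + (j == z)%:R * (x i 0 * y j 0 * (d * (i == z)%:R * w 0 z + w 0 i))
     + x i 0 * (i == z)%:R * (w 0 j * y j 0))).
    by apply: eq_bigr => j _; rewrite (eq_sym i j); ring.
  by rewrite !big_split /= !sum_deltal -mulr_sumr mxE; ring.
rewrite !big_split /= !sum_deltal -!mulr_sumr [(w *m x) _ _]mxE.
have -> : (x^T *m diag_mx (\row_i e i) *m y) 0 0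
    = \sum_i x i 0 * e i * y i 0.
  by rewrite mul_mx_diag mxE; apply: eq_bigr => i _; rewrite !mxE.
by ring.
Qed.

(* The symbols are built from the form [diag e], the vector [e_z] and the
   covector [e^z] only, so any isometry of the form fixing both preserves
   them. *)
Lemma warped_invariant (R : realType) (m : nat) (e : 'I_m -> R) (z : 'I_m)
    (c d : R) (T : 'M[R]_m) :
  T \in unitmx -> T^T *m diag_mx (\row_i e i) *m T = diag_mx (\row_i e i) ->
  T *m delta_mx z (0 : 'I_1) = delta_mx z 0 ->
  delta_mx (0 : 'I_1) z *m T = delta_mx 0 z ->
  chr_act T (warped R m e z c d) = warped R m e z c d.
Proof.
move=> uT isoT Tz zT; apply/funext => i; apply/funext => j; apply/funext => k.
have Tzi a : (T *m delta_mx a (0 : 'I_1)) z 0 = (a == z)%:R.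
  move/matrixP: zT => /(_ 0 a); rewrite -rowE -colE !mxE => ->.
  by rewrite eqxx.
have Ti a : (delta_mx (0 : 'I_1) k *m invmx T *m (T *m delta_mx a (0 : 'I_1)))
     0 0 = (k == a)%:R.
  rewrite mulmxA mulmxKV // mul_delta_mx_cond.
  by case: eqP => _; rewrite ?mulr1n ?mulr0n !mxE ?eqxx.
(* The [z]-component of a covector is its pairing with e_z = T e_z, so the invariance [Ti] of the
   pairing applies. *)
have wz : (delta_mx (0 : 'I_1) k *m invmx T) 0 z = (k == z)%:R.
  have -> : (delta_mx (0 : 'I_1) k *m invmx T) 0 z =
     (delta_mx (0 : 'I_1) k *m invmx T *m delta_mx z (0 : 'I_1)) 0 0.
    by rewrite -(colE z) [RHS]mxE.
  by rewrite -[X in _ *m X]Tz Ti.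
rewrite /chr_act chr_eval_warped !Tzi !Ti wz trmx_mul -!mulmxA.
rewrite [T^T *m _]mulmxA [_ *m (T *m _)]mulmxA isoT trmx_delta -rowE -colE.
rewrite !mxE.
rewrite /warped; congr (_ * _ * _ + _ + _).
by case: (eqVneq i j) => [->|_]; rewrite /= ?mulr1n ?mulr0n; ring.
Qed.

(** * Hyperbolic rotations *)

Definition boost (R : realType) (m : nat) (a b : 'I_m) (ch sh : R) : 'M[R]_m :=
  1%:M + ((ch - 1) *: (delta_mx a a + delta_mx b b)
  + sh *: (delta_mx a b + delta_mx b a)).

Lemma tr_boost (R : realType) (m : nat) (a b : 'I_m) (ch sh : R) :
  (boost R m a b ch sh)^T = boost R m a b ch sh.
Proof.
by apply/matrixP => i j; rewrite !mxE [j == i]eq_sym ![(j == _) && _]andbC; ring.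
Qed.

(** With [P] the projection onto the plane of e_a, e_b and [Q] the swap inside it, [P] is a unit for
    [Q] and Q^2 = P, so the product is 1 + (ch^2 - sh^2 - 1) P. *)
Lemma mul_boostN (R : realType) (m : nat) (a b : 'I_m) (ch sh : R) :
  a != b -> ch ^+ 2 - sh ^+ 2 = 1 ->
  boost R m a b ch sh *m boost R m a b ch (- sh) = 1%:M.
Proof.
move=> /negPf nab h1; rewrite /boost.
set P := _ + delta_mx b b; set Q := _ + delta_mx b a.
have nba : (b == a) = false by rewrite eq_sym.
have [[PP PQ] [QP QQ]] :
    (P *m P = P /\ P *m Q = Q) /\ (Q *m P = Q /\ Q *m Q = P).
  by rewrite !mulmxDl !mulmxDr !mul_delta_mx_cond !eqxx nab nba !mulr0n !mulr1n
    !addr0 !add0r.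
rewrite mulmxDl mul1mx mulmxDr mulmx1 mulmxDl !mulmxDr.
rewrite -!scalemxAl -!scalemxAr PP PQ QP QQ.
move: P Q {PP PQ QP QQ} => P Q; apply/matrixP => i j; rewrite !mxE.
transitivity ((i == j)%:R + (ch ^+ 2 - sh ^+ 2 - 1) * P i j); first by ring.
by rewrite h1; ring.
Qed.

(** Cancelling the inverse from [mul_boostN] leaves D B(sh) = B(-sh) D with D = diag e: moving D
    across flips the sign of [sh], because [e a] and [e b] are opposite. *)
Lemma boost_isometry (R : realType) (m : nat) (e : 'I_m -> R) (a b : 'I_m)
    (ch sh : R) :
  e a = - 1 -> e b = 1 -> ch ^+ 2 - sh ^+ 2 = 1 ->
  (boost R m a b ch sh)^T *m diag_mx (\row_i e i) *m boost R m a b ch sh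
  = diag_mx (\row_i e i).
Proof.
move=> ea eb h1.
have nab : a != b by apply/eqP => eab; move: ea; rewrite eab eb; lra.
have -> : boost R m a b ch sh = (boost R m a b ch sh)^T by rewrite tr_boost.
rewrite trmxK -mulmxA -[X in _ = X]mul1mx -(mul_boostN _ _ _ _ _ _ nab h1).
rewrite -mulmxA.
congr (_ *m _); rewrite tr_boost mul_diag_mx mul_mx_diag.
apply/matrixP => i j; rewrite !mxE.
have casesP x : [\/ x = a, x = b | (x == a) = false /\ (x == b) = false].
  case: (eqVneq x a) => ?; first exact: Or31.
  by case: (eqVneq x b) => ?; [exact: Or32 | exact: Or33].
have nba : (b == a) = false by rewrite eq_sym (negPf nab).
case: (casesP i) => [->|->|[nia nib]]; case: (casesP j) => [->|->|[nja njb]];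
  rewrite ?[a == j]eq_sym ?[b == j]eq_sym ?ea ?eb ?(negPf nab) ?nba ?nia ?nib
    ?nja ?njb ?eqxx /=; try ring.
by case: (eqVneq i j) => [->|_] /=; ring.
Qed.

(** * Unbounded stabilizers obstruct compactness and properness *)

Lemma unbounded_entry_not_compact (R : realType) (m n : nat)
    (A : set 'M[R]_(m, n)) (i : 'I_m) (j : 'I_n) :
  (forall k : nat, exists2 T, A T & k%:R <= T i j) -> ~ compact A.
Proof.
move=> unb cA.
have /compact_bounded [M [_ /(_ (M + 1))]] :
    compact [set (T : 'M[R]_(m, n)) i j | T in A].
  by apply: continuous_compact cA; apply: continuous_subspaceT => T;
    exact: coord_continuous.
(* Every real above [M] is a bound; [M + 1] is the one used. *)
rewrite ltrDl ltr01 => /(_ isT) bnd.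
have [T AT] := unb (Num.truncn (M + 1)).+1.
apply/negP; rewrite -ltNge (le_lt_trans _ (truncnS_gt _)) //.
by rewrite (le_trans (ler_norm _)) // bnd //; exists T.
Qed.

(** Stabilizer elements with growing entries act on the constant sequence [G], which they leave
    constant; a convergent subsequence of them would have bounded entries. *)
Lemma unbounded_stab_not_proper (R : realType) (m : nat)
    (N : set (christoffel R m)) (G : christoffel R m) (i j : 'I_m) :
  N G -> (forall k : nat, exists2 T, GLplus_stab G T & k%:R <= T i j) ->
  ~ proper_action (GLplus R m) N (@chr_act R m).
Proof.
move=> NG unb prop.
have /choice [g gP] (k : nat) : exists T, GLplus_stab G T /\ k%:R <= T i j.
  by have [T ? ?] := unb k; exists T.
have [||||||s [h [smono _ gh]]] := prop (fun=> G) g G G.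
- by [].
- by move=> k; have [[]] := gP k.
- by [].
- by [].
- exact: cvg_cst.
- have -> : (fun n => chr_act (g n) G) = fun=> G; last exact: cvg_cst.
  by apply/funext => k; have [[]] := gP k.
have cv : (fun k => g (s k) i j) @ \oo --> h i j.
  apply: (continuous_cvg (f := g \o s) (h := fun M : 'M[R]_m => M i j) _ _ gh).
  exact: coord_continuous.
have : cvgn (fun k => g (s k) i j) by apply/cvg_ex; exists (h i j).
move=> /cvg_seq_bounded [M [_ /(_ (M + 1))]].
rewrite ltrDl ltr01 => /(_ isT) bnd.
(* A strictly increasing [s] dominates the identity, so the entries still grow along the
   subsequence. *)
have ks k : (k <= s k)%N.
  by elim: k => // k IH; apply: leq_ltn_trans IH (smono _ _ _).
have := (gP (s (Num.truncn (M + 1)).+1)).2.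
apply/negP; rewrite -ltNge.
apply: le_lt_trans (lt_le_trans (truncnS_gt (M + 1)) _).
  by apply: le_trans (ler_norm _) (bnd _ _).
by rewrite ler_nat.
Qed.

(** * Unbounded isotropy and choice of constants *)

Lemma warped_stab_unbounded (R : realType) (m : nat) (e : 'I_m -> R)
    (a b z : 'I_m) (c d : R) :
  e a = - 1 -> e b = 1 -> z != a -> z != b ->
  forall k : nat,
    exists2 T, GLplus_stab (warped R m e z c d) T & k%:R <= T a a.
Proof.
move=> ea eb nza nzb k.
have nab : a != b by apply/eqP => eab; move: ea; rewrite eab eb; lra.
(* Taking sinh = k forces this value of cosh. *)
pose ch : R := Num.sqrt (1 + k%:R ^+ 2).
have hch : ch ^+ 2 = 1 + k%:R ^+ 2 by rewrite sqr_sqrtr // addr_ge0 // sqr_ge0.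
have h1 : ch ^+ 2 - k%:R ^+ 2 = 1 by rewrite hch; ring.
pose B := boost R m a b ch k%:R.
have uB : B \in unitmx.
  by case: (mulmx1_unit (mul_boostN R m a b ch k%:R nab h1)).
have isoB := boost_isometry R m e a b ch k%:R ea eb h1.
have Bz : B *m delta_mx z (0 : 'I_1) = delta_mx z 0.
  rewrite /B /boost !mulmxDl mul1mx -!scalemxAl !mulmxDl !mul_delta_mx_cond.
  rewrite ![_ == z]eq_sym (negPf nza) (negPf nzb) !mulr0n !addr0 !scaler0.
  by rewrite !addr0.
have zB : delta_mx (0 : 'I_1) z *m B = delta_mx 0 z.
  by apply: trmx_inj; rewrite trmx_mul trmx_delta tr_boost.
(* Squaring makes the determinant positive. *)
exists (B *m B).
  split.
    rewrite /GLplus /= det_mulmx -expr2 lt_neqAle sqr_ge0 andbT eq_sym.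
    by rewrite expf_eq0 /= -unitfE -unitmxE.
  apply: warped_invariant.
  - by rewrite unitmx_mul uB.
  - by rewrite trmx_mul -[RHS]isoB -[in RHS]isoB !mulmxA.
  - by rewrite -mulmxA !Bz.
  - by rewrite mulmxA !zB.
(* Only the indices [a] and [b] contribute: the entry is ch^2 + k^2 = 1 + 2 k^2, which is at least
   k. *)
rewrite mxE (bigD1 a) //= (bigD1 b) 1?eq_sym //= big1 => [|i /andP[nia nib]].
  rewrite !mxE !eqxx [b == a]eq_sym (negPf nab) /=.
  have : (k%:R : R) <= k%:R ^+ 2 by rewrite -natrX ler_nat; nia.
  nra.
by rewrite !mxE (negPf nia) (negPf nib) eq_sym (negPf nia) /=; ring.
Qed.

Theorem theorem1p9 (R : realType) (p q : nat)
    (hp : (1 <= p)%N) (hq : (1 <= q)%N) (hpq : (3 <= p + q)%N) :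
  [/\ exists2 G : christoffel R (p + q),
        Zpq R p q G & ~ compact (GLplus_stab G),
      ~ proper_action (GLplus R (p + q)) (Zpq R p q) (@chr_act R (p + q)) &
      ~ proper_action (GLplus R (p + q)) (Wpq R p q) (@chr_act R (p + q))].
Proof.
pose e (i : 'I_(p + q)) : R := if (i < p)%N then - 1 else 1.
have ha : (0 < p + q)%N by lia.
have hz : (1 < p + q)%N by lia.
have hb : ((p + q).-1 < p + q)%N by lia.
(* The first index is negative, the last positive; index 1 differs from both as p + q is at least 3,
   and its sign may be either. *)
pose a := Ordinal ha; pose z := Ordinal hz; pose b := Ordinal hb.
have ea : e a = - 1 by rewrite /e /= hp.
have eb : e b = 1 by rewrite /e /= ifF //; lia.
have nzb : z != b by rewrite -val_eqE /=; lia.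
pose n : R := (p + q)%:R - 1.
have n2 : 2 <= n by rewrite /n lerBrDr (_ : 2 + 1 = 3%:R) ?ler_nat //; ring.
have ez : - 1 <= e z by rewrite /e; case: ifP => _; lra.
(* Solution of the system in [ricci_warped_diag], with n = m - 1: the second equation gives c e_z +
   d = e_z / n - 1, and then the first becomes c (n - 1 + e_z / n) = 1. The denominator is positive
   since n is at least 2 and e_z at least -1. *)
pose c := n / (n * (n - 1) + e z).
pose d := e z / n - 1 - c * e z.
have n0 : n != 0 by rewrite gt_eqF //; lra.
have D0 : n * (n - 1) + e z != 0 by rewrite gt_eqF //; nra.
pose G := warped R (p + q) e z c d.
have ric j k : ricci G j k = e k * (j == k)%:R.
  apply: ricci_warped_diag; rewrite -/n /d.
    rewrite (_ : _ + _ = n - 1 + e z / n); last by rewrite /n; ring.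
    by rewrite /c; field; rewrite n0.
  by field.
have ZG : Zpq R p q G.
  split; first exact: warped_torsion_free.
  (* The standard basis is already adapted, as [e] lists the p negative signs first. *)
  exists 1%:M; first exact: unitmx1.
  rewrite trmx1 mulmx1 mul1mx; apply/matrixP => j k.
  have -> : ricci_sym G j k = e k * (j == k)%:R.
    rewrite /ricci_sym 2!mxE [_^T _ _]mxE !ric [k == j]eq_sym.
    by case: (eqVneq j k) => [->|_] /=; field.
  rewrite /e; case: (split_ordP j) => j' ->; case: (split_ordP k) => k' ->.
  - by rewrite block_mxEul !mxE eq_lshift /= mulN1r.
  - by rewrite block_mxEur mxE eq_lrshift mulr0.
  - by rewrite block_mxEdl mxE eq_rlshift mulr0.
  - by rewrite block_mxEdr mxE eq_rshift /= mul1r.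
have unb := warped_stab_unbounded R (p + q) e a b z c d ea eb isT nzb.
split.
- by exists G => //; apply: unbounded_entry_not_compact unb.
- exact: unbounded_stab_not_proper ZG unb.
- by apply: unbounded_stab_not_proper unb; case: ZG.
Qed.
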